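(* Let $(C_{\leq_C},\alpha,\gamma,A_{\leq_A})$ be a Galois insertion, where $\langle C,\leq_C\rangle$ is a complete lattice, and let $f:C\to C$ be a monotonic function. For all $c'\in C$ and $a'\in A$: (a) $\gamma(\mathrm{lfp}(\alpha f\gamma))\leq_C c' \iff \exists a\in A.\; f(\gamma(a))\leq_C\gamma(a)\ \wedge\ \gamma(a)\leq_C c'$; (b) $\mathrm{lfp}(\alpha f\gamma)\leq_A a' \iff \exists a\in A.\; f(\gamma(a))\leq_C\gamma(a)\ \wedge\ \gamma(a)\leq_C\gamma(a')$.
   Context: A Galois connection between posets $\langle C,\leq_C\rangle$ and $\langle A,\leq_A\rangle$ is a pair of maps $\alpha:C\to A$, $\gamma:A\to C$ with $\alpha(c)\leq_A a\iff c\leq_C\gamma(a)$ for all $c\in C,a\in A$; it is a Galois insertion when $\alpha$ is surjective (equivalently, $\gamma$ is injective). The composition $\alpha\circ f\circ\gamma:A\to A$ is written $\alpha f\gamma$, and $\mathrm{lfp}(g)$ denotes the least fixpoint of $g$. *)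

(* Defs.v *)
From HB Require Import structures.
From mathcomp Require Export all_boot all_order.
From mathcomp Require Export boolp classical_sets functions.

Set Implicit Arguments.
Unset Strict Implicit.
Unset Printing Implicit Defensive.

Import Order.Theory.

Local Open Scope classical_set_scope.
Local Open Scope order_scope.

(* [S] ranges over all subsets, [set0] included, so that a complete lattice has
   a least and a greatest element.  MathComp's [latticeType] has only binary
   meets and joins; [supremums] and [infimums] need only a [porderType]. *)
Definition complete_lattice (d : Order.disp_t) (C : porderType d) : Prop :=
  forall S : set C, supremums S !=set0 /\ infimums S !=set0.

Definition galois_connection (dC dA : Order.disp_t)
    (C : porderType dC) (A : porderType dA) (alpha : C -> A) (gamma : A -> C)
    : Prop :=
  forall (c : C) (a : A), alpha c <= a <-> c <= gamma a.

Definition galois_insertion (dC dA : Order.disp_t)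
    (C : porderType dC) (A : porderType dA) (alpha : C -> A) (gamma : A -> C)
    : Prop :=
  galois_connection alpha gamma /\ set_surj [set: C] [set: A] alpha.

(* Relational rendering of [lfp g = x]: such an [x] is unique by antisymmetry,
   but need not exist for an arbitrary [g]. *)
Definition is_lfp (d : Order.disp_t) (T : porderType d) (g : T -> T) (x : T)
    : Prop :=
  g x = x /\ forall y : T, g y = y -> x <= y.

(* Main.v *)
(* Every subset of A has an infimum, namely alpha of the infimum of its gamma-image.  Knaster-Tarski then makes
   lfp(alpha f gamma) the least a with alpha (f (gamma a)) <= a, which by
   adjunction is the condition f (gamma a) <= gamma a; since gamma is an order
   embedding, both equivalences follow. *)
Require Import Defs.

Set Implicit Arguments.
Unset Strict Implicit.
Unset Printing Implicit Defensive.

Import Order.Theory.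

Local Open Scope order_scope.

(** By monotonicity [g l] is below every prefixpoint, hence below [l]; then [g l] is itself a
    prefixpoint, which gives [l <= g l]. *)
Lemma is_lfp_infimum (d : Order.disp_t) (T : porderType d) (g : T -> T) (l : T) :
  {homo g : x y / x <= y} -> infimums [set x | g x <= x]%classic l ->
  is_lfp g l.
Proof.
move=> hg [lb_l glb_l].
have gl_le : g l <= l.
  by apply: glb_l => x gx_le; exact: le_trans (hg _ _ (lb_l _ gx_le)) gx_le.
split=> [|y gy]; last by apply: lb_l; rewrite /= gy.
by apply/le_anti; rewrite gl_le; apply: lb_l; exact: hg.
Qed.

Section Galois.
Variables (dC dA : Order.disp_t) (C : porderType dC) (A : porderType dA).
Variables (alpha : C -> A) (gamma : A -> C).

Section Connection.
Hypothesis gc : galois_connection alpha gamma.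

Lemma galois_counit (a : A) : alpha (gamma a) <= a.
Proof. exact/gc. Qed.

Lemma galois_unit (c : C) : c <= gamma (alpha c).
Proof. exact/gc. Qed.

Lemma galois_alpha_homo : {homo alpha : x y / x <= y}.
Proof. by move=> x y xy; apply/gc/(le_trans xy)/galois_unit. Qed.

Lemma galois_gamma_homo : {homo gamma : x y / x <= y}.
Proof. by move=> x y xy; apply/gc/(le_trans _ xy)/galois_counit. Qed.

End Connection.

Hypothesis gi : galois_insertion alpha gamma.

(** Surjectivity lets [a] be written [alpha c]; applying [alpha] to the unit at [c] gives the
    inequality opposite to the counit. *)
Lemma galois_insertionK : cancel gamma alpha.
Proof.
case: gi => gc alpha_surj a; apply/le_anti; rewrite galois_counit //=.
have [c _ <-] := alpha_surj a I.
exact/galois_alpha_homo/galois_unit.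
Qed.

(** If [b] bounds [S] from below, then [gamma b] bounds the image, so [gamma b <= c]; applying
    [alpha] recovers [b <= alpha c]. *)
Lemma galois_insertion_infimum (S : set A) (c : C) :
  infimums (gamma @` S)%classic c -> infimums S (alpha c).
Proof.
case: gi => gc _ [lb_c glb_c]; split=> [a Sa|b lb_b].
  by apply/gc/lb_c; exists a.
rewrite -[b]galois_insertionK; apply/galois_alpha_homo/glb_c => // _ [a Sa <-].
exact/galois_gamma_homo/lb_b.
Qed.

End Galois.

Theorem lemma3p2 (dC dA : Order.disp_t) (C : porderType dC) (A : porderType dA)
    (alpha : C -> A) (gamma : A -> C) (f : C -> C)
    (hC : complete_lattice C)
    (hins : galois_insertion alpha gamma)
    (hf : {homo f : x y / x <= y}) :
  exists l : A, is_lfp (alpha \o f \o gamma) l /\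
    forall (c' : C) (a' : A),
      (gamma l <= c' <->
         exists a : A, f (gamma a) <= gamma a /\ gamma a <= c') /\
      (l <= a' <->
         exists a : A, f (gamma a) <= gamma a /\ gamma a <= gamma a').
Proof.
have [gc _] := hins.
pose g := alpha \o f \o gamma.
have g_homo : {homo g : x y / x <= y}.
  by move=> x y xy; apply/(galois_alpha_homo gc)/hf/(galois_gamma_homo gc).
have [_ [c inf_c]] := hC (gamma @` [set a | (g a <= a)%O])%classic.
have inf_l := galois_insertion_infimum hins inf_c.
have lfp_l := is_lfp_infimum g_homo inf_l.
exists (alpha c); split=> // c' a'.
(* The least fixpoint is its own witness in both forward directions. *)
have fl_le : f (gamma (alpha c)) <= gamma (alpha c).
  by apply/gc; have [+ _] := lfp_l; rewrite /g /= => ->.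
have l_le a : f (gamma a) <= gamma a -> alpha c <= a.
  by move=> fa_le; apply: inf_l.1; apply/gc.
split; split.
- by move=> l_c'; exists (alpha c).
- by case=> a [/l_le/(galois_gamma_homo gc)]; apply: le_trans.
- by move=> l_a'; exists (alpha c); split=> //; apply: (galois_gamma_homo gc).
(* Here [gamma] reflects the order: the adjunction turns [gamma a <= gamma a'] into
   [alpha (gamma a) <= a'], that is [a <= a']. *)
- case=> a [/l_le l_a /gc]; rewrite (galois_insertionK hins).
  exact: le_trans.
Qed.
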